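(* Let $z\in\mathrm{Hilb}$ be a Borel-fixed point with degree-$m$ filter $\mathcal F$ and order ideal $\mathcal R$. A nonzero tangent vector $(c_{AB})_{A\in\mathcal F,B\in\mathcal R}\in T_z\mathrm{Hilb}$, i.e. the first-order deformation $(\mathbf x^A+\varepsilon\sum_{B\in\mathcal R}c_{AB}\mathbf x^B\mid A\in\mathcal F)$, is an eigenvector for the Borel subgroup of invertible upper-triangular matrices if and only if: (1) there exists $K\in\mathbb Z^{n+1}$ with entries summing to $0$ such that $c_{AB}\neq0\implies B-A=K$; and (2) with $\mathcal F'=\mathcal F\setminus\{A\in\mathcal F:\exists B\in\mathcal R,\ c_{AB}\neq0\}$ and $\mathcal F''=\mathcal F\cup\{B\in\mathcal R:\exists A\in\mathcal F,\ c_{AB}\neq0\}$: (i) $\mathcal F'$ and $\mathcal F''$ are filters of $\mathcal P(m,n)$; (ii) for each $A=(a_0,\dots,a_n)\in\mathcal F\setminus\mathcal F'$ with $B=A+K=(b_0,\dots,b_n)$ and each $i\in\{1,\dots,n\}$, if $A+\Delta_i\in\mathcal F\setminus\mathcal F'$ then $c_{A+\Delta_i,B+\Delta_i}=\frac{b_i}{a_i}c_{AB}$.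
   Context: $K$ algebraically closed of characteristic $0$, $S=K[x_0,\dots,x_n]$; $g=(a_{ij})\in\mathrm{GL}(n+1,K)$ acts by $x_i\mapsto\sum_j a_{ji}x_j$. $\mathrm{Hilb}\subseteq\mathrm{Grass}(r,S_m)$ is the Hilbert scheme of subschemes of $\mathbb P^n$ with a fixed Hilbert polynomial, embedded via $Z\mapsto I_m$ where $I$ is the saturated ideal of $Z$ and $m$ is the Gotzmann number (so $m$ is at least the regularity of every such ideal). $z$ is Borel-fixed if its ideal is fixed by all invertible upper-triangular matrices. $\mathcal F$ (resp. $\mathcal R$) is the set of exponent vectors of degree-$m$ monomials in (resp. not in) $I_m$. $T_z\mathrm{Grass}=\mathrm{Hom}_K(I_m,S_m/I_m)$, with $(c_{AB})$ meaning $\mathbf x^A\mapsto\sum_{B}c_{AB}\mathbf x^B$, equivalently the ideal of $S[\varepsilon]$ ($\varepsilon^2=0$) generated by $\mathbf x^A+\varepsilon\sum_Bc_{AB}\mathbf x^B$, $A\in\mathcal F$; it lies in $T_z\mathrm{Hilb}$ iff that ideal is flat over $K[\varepsilon]$. The Borel subgroup fixes $z$ and acts on $T_z\mathrm{Hilb}$ by acting on this ideal (on the $x_i$, fixing $\varepsilon$) and rewriting the degree-$m$ part with generators $\mathbf x^A+\varepsilon\sum_Bc'_{AB}\mathbf x^B$. An eigenvector is a nonzero $v$ with $g\cdot v\in Kv$ for all $g$ in the group. $E_i$ denotes the $i$-th standard basis vector of $\mathbb Z^{n+1}$ (indices $0,\dots,n$), $\Delta_i=E_{i-1}-E_i$.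 $\mathcal P(m,n)$ is the poset of degree-$m$ exponent vectors with order generated by $A\prec A+\Delta_i$; a filter is an up-closed subset. *)

(* Defs.v *)
From HB Require Import structures.
From mathcomp Require Import all_boot all_order all_algebra.
From mathcomp Require Import mpoly.
Set Implicit Arguments. Unset Strict Implicit. Unset Printing Implicit Defensive.
Import Order.TTheory GRing.Theory Num.Theory.
Local Open Scope ring_scope.

Definition Spoly (K : fieldType) (n : nat) := {mpoly K[n.+1]}.

Definition Exps (n m : nat) :=
  {A : {ffun 'I_n.+1 -> 'I_m.+1} | (\sum_(i < n.+1) (A i : nat)) == m}.

Definition ex (n m : nat) (A : Exps n m) (i : 'I_n.+1) : nat := val (val A i).

Definition mono (K : fieldType) (n m : nat) (A : Exps n m) : Spoly K n :=
  \prod_(i < n.+1) 'X_i ^+ ex A i.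

Definition Delta (n : nat) (i j : 'I_n.+1) : int :=
  (j == i.-1 :> nat)%:Z - (j == i :> nat)%:Z.

Definition shifted (n m : nat) (i : 'I_n.+1) (A A' : Exps n m) : Prop :=
  forall j, (ex A' j)%:Z = (ex A j)%:Z + Delta i j.

(** Filters (up-closed subsets) of P(m,n), whose order is generated by A < A + Delta_i,
    i in {1,...,n}. *)
Definition is_filter (n m : nat) (G : {set Exps n m}) : Prop :=
  forall (i : 'I_n.+1) (A A' : Exps n m),
    (0 < i)%N -> A \in G -> shifted i A A' -> A' \in G.

Definition is_ideal (K : fieldType) (n : nat) (I : pred (Spoly K n)) : Prop :=
  [/\ I 0, (forall f g, I f -> I g -> I (f + g)) & (forall r f, I f -> I (r * f))].

Definition hcomp (K : fieldType) (n : nat) (d : nat) (p : Spoly K n) : Spoly K n :=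
  \sum_(u <- msupp p | mdeg u == d) p@_u *: 'X_[u].

Definition is_homog_ideal (K : fieldType) (n : nat) (I : pred (Spoly K n)) : Prop :=
  is_ideal I /\ forall f d, I f -> I (hcomp d f).

(** I saturated: I = (I : (x_0,...,x_n)^infty); (x_0..x_n)^k is generated by the
    monomials of degree k. *)
Definition saturated (K : fieldType) (n : nat) (I : pred (Spoly K n)) : Prop :=
  forall f, (exists k, forall u : 'X_{1..n.+1}, mdeg u = k -> I ('X_[u] * f)) -> I f.

Definition lin_indep (K : fieldType) (n k : nat) (f : 'I_k -> Spoly K n) : Prop :=
  forall a : 'I_k -> K, \sum_(i < k) a i *: f i = 0 -> forall i, a i = 0.

Definition dim_deg (K : fieldType) (n : nat) (I : pred (Spoly K n)) (t k : nat) : Prop :=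
  (exists f : 'I_k -> Spoly K n,
      (forall i, I (f i) /\ f i \is t.-homog) /\ lin_indep f) /\
  (forall f : 'I_k.+1 -> Spoly K n,
      (forall i, I (f i) /\ f i \is t.-homog) -> ~ lin_indep f).

(** P is the Hilbert polynomial of S/I: dim (S/I)_t = C(t+n,n) - dim I_t = P(t), t >> 0. *)
Definition hilbert_poly (K : fieldType) (n : nat) (I : pred (Spoly K n))
  (P : {poly rat}) : Prop :=
  exists t0, forall t, (t0 <= t)%N ->
    exists k, dim_deg I t k /\ P.[t%:R] = ('C(t + n, n))%:R - k%:R.

Definition binpoly (x : {poly rat}) (a : nat) : {poly rat} :=
  (a`!%:R)^-1 *: \prod_(j < a) (x - (j%:R)%:P).

Definition gotzmann_number (P : {poly rat}) (m : nat) : Prop :=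
  exists a : seq nat, size a = m /\ sorted geq a /\
    P = \sum_(i < m) binpoly ('X + ((nth 0 a i)%:R - i%:R)%:P) (nth 0 a i).

Definition borel (K : fieldType) (n : nat) (g : 'M[K]_n.+1) : Prop :=
  g \in unitmx /\ forall i j : 'I_n.+1, (j < i)%N -> g i j = 0.

Definition gact (K : fieldType) (n : nat) (g : 'M[K]_n.+1) (p : Spoly K n) : Spoly K n :=
  comp_mpoly [tuple \sum_(j < n.+1) g j i *: 'X_j | i < n.+1] p.

Definition borel_fixed (K : fieldType) (n : nat) (I : pred (Spoly K n)) : Prop :=
  forall g, borel g -> forall f, I f <-> exists h, I h /\ f = gact g h.

(** ---------- S[eps], eps^2 = 0, represented as pairs (s0,s1) = s0 + eps s1 ---------- *)
Definition DS (K : fieldType) (n : nat) := (Spoly K n * Spoly K n)%type.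

(** ideal of S[eps] generated by u_A + eps v_A, A in F *)
Definition gen_ideal (K : fieldType) (n m : nat) (F : {set Exps n m})
  (u v : Exps n m -> Spoly K n) (x : DS K n) : Prop :=
  exists p q : Exps n m -> Spoly K n,
    x.1 = \sum_(A in F) p A * u A /\
    x.2 = \sum_(A in F) (p A * v A + q A * u A).

(** S[eps]/J is flat over K[eps]: the map (eps) (x) M -> M is injective, i.e.
    every element of M killed by eps lies in eps M. *)
Definition flat_quot (K : fieldType) (n : nat) (J : DS K n -> Prop) : Prop :=
  forall u : Spoly K n, J (0, u) -> exists w, J (u, w).

Definition Fset (K : fieldType) (n m : nat) (I : pred (Spoly K n)) : {set Exps n m} :=
  [set A | I (mono K A)].
Definition Rset (K : fieldType) (n m : nat) (I : pred (Spoly K n)) : {set Exps n m} :=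
  ~: Fset m I.

Definition defo_ideal (K : fieldType) (n m : nat) (I : pred (Spoly K n))
  (c : Exps n m -> Exps n m -> K) : DS K n -> Prop :=
  gen_ideal (Fset m I) (@mono K n m)
    (fun A => \sum_(B in Rset m I) c A B *: mono K B).

(** c is an element of T_z Grass = Hom(I_m, S_m/I_m) (entries only for A in F, B in R)
    lying in T_z Hilb. *)
Definition tangent_Hilb (K : fieldType) (n m : nat) (I : pred (Spoly K n))
  (c : Exps n m -> Exps n m -> K) : Prop :=
  (forall A B, c A B != 0 -> A \in Fset m I /\ B \in Rset m I) /\
  flat_quot (defo_ideal I c).

Definition gimage (K : fieldType) (n : nat) (g : 'M[K]_n.+1) (J : DS K n -> Prop)
  (x : DS K n) : Prop :=
  exists y, J y /\ x = (gact g y.1, gact g y.2).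

(** g . c = c' : g.J is rewritten with generators x^A + eps sum_B c'_AB x^B *)
Definition borel_act (K : fieldType) (n m : nat) (I : pred (Spoly K n))
  (g : 'M[K]_n.+1) (c c' : Exps n m -> Exps n m -> K) : Prop :=
  (forall A B, c' A B != 0 -> A \in Fset m I /\ B \in Rset m I) /\
  forall x, gimage g (defo_ideal I c) x <-> defo_ideal I c' x.

Definition borel_eigen (K : fieldType) (n m : nat) (I : pred (Spoly K n))
  (c : Exps n m -> Exps n m -> K) : Prop :=
  (exists A B, c A B != 0) /\
  forall g, borel g -> exists c', borel_act I g c c' /\
     exists lam : K, forall A B, c' A B = lam * c A B.

(* Main.v *)
Require Import Defs.
From HB Require Import structures.
From mathcomp Require Import all_boot all_order all_algebra.
From mathcomp Require Import mpoly ring zify.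
Import Order.TTheory GRing.Theory Num.Theory.
Local Open Scope ring_scope.
Set Implicit Arguments. Unset Strict Implicit. Unset Printing Implicit Defensive.

(* Modulo I_m the tangent vector is a linear map phi : I_m -> S_m / I_m, on which a group
   element g acts by g phi g^-1. A diagonal g multiplies c_AB by a character of weight
   B - A, so being a torus eigenvector is condition (1). For g : x_i |-> x_i + x_{i-1} the
   eigenvalue is 1, and comparing the coefficients of x^(B + Delta_i) shows that phi
   commutes with the derivation D_i = x_{i-1} d/dx_i; on monomials this is condition (2).
   Conversely, if phi commutes with all D_i, it commutes with their brackets x_k d/dx_j
   (k < j), hence with the substitutions x_j |-> x_j + h, h in the span of the x_k with
   k < j, which are the exponentials of h d/dx_j. Together with the scalings of single
   variables these compose to every upper-triangular g. *)

Lemma natr_inj_pchar0 (K : fieldType) : [pchar K] =i pred0 ->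
  injective (fun a : nat => a%:R : K).
Proof.
move=> /pcharf0P K0.
suff le a b : a%:R = b%:R :> K -> (b <= a)%N.
  by move=> a b /= eab; apply/eqP; rewrite eqn_leq !le.
move=> eab; rewrite leqNgt; apply/negP => lab.
have : (b - a)%:R == 0 :> K by rewrite natrB ?(ltnW lab) // eab subrr.
by rewrite K0 subn_eq0 leqNgt lab.
Qed.

(** * Exponent vectors as multinomials, shifts by [Delta], coefficients of monomials *)

Definition exm (n m : nat) (A : Exps n m) : 'X_{1..n.+1} := [multinom ex A i | i < n.+1].

Lemma exmE (n m : nat) (A : Exps n m) i : exm A i = ex A i.
Proof. exact: mnmE. Qed.

Lemma mono_mpolyX (K : fieldType) (n m : nat) (A : Exps n m) : mono K A = 'X_[exm A].
Proof. by rewrite mpolyXE_id; apply: eq_bigr => i _; rewrite exmE. Qed.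

Lemma exm_inj (n m : nat) : injective (@exm n m).
Proof.
move=> A B /mnmP e; apply/val_inj/ffunP => i; apply/val_inj.
by have := e i; rewrite !exmE.
Qed.

Lemma mdeg_exm (n m : nat) (A : Exps n m) : mdeg (exm A) = m.
Proof. by rewrite mdegE (eq_bigr _ (fun i _ => exmE A i)); apply/eqP/(valP A). Qed.

Lemma exm_surj (n m : nat) (u : 'X_{1..n.+1}) : mdeg u = m -> exists A : Exps n m, exm A = u.
Proof.
move=> du.
have lu i : (u i < m.+1)%N by rewrite ltnS -du mdegE (bigD1 i) //= leq_addr.
pose f := [ffun i => Ordinal (lu i)].
have fP : \sum_(i < n.+1) (f i : nat) == m.
  by apply/eqP; rewrite -[RHS]du mdegE; apply: eq_bigr => i _; rewrite ffunE.
exists (exist (fun A : {ffun 'I_n.+1 -> 'I_m.+1} => \sum_(i < n.+1) (A i : nat) == m) f fP).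
by apply/mnmP => i; rewrite exmE /ex /= ffunE.
Qed.

Definition opred (n : nat) (i : 'I_n.+1) : 'I_n.+1 := inord i.-1.

Lemma opredE (n : nat) (i : 'I_n.+1) : opred i = i.-1 :> nat.
Proof. by rewrite inordK // (leq_ltn_trans (leq_pred i)). Qed.

Lemma opred_neq (n : nat) (i : 'I_n.+1) : (0 < i)%N -> opred i != i.
Proof. by move=> i0; rewrite -(inj_eq val_inj) /= opredE; case: (i : nat) i0 => // k _; rewrite ltn_eqF. Qed.

(** Moving the entry -1 of [Delta i] to the other side avoids truncated subtraction. For i = 0 the
    predecessor is 0 again, and both sides say that A' = A. *)
Lemma shiftedE (n m : nat) (i : 'I_n.+1) (A A' : Exps n m) :
  shifted i A A' <-> (exm A' + U_(i) = exm A + U_(opred i))%MM.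
Proof.
split=> [sh | /mnmP sh j].
  apply/mnmP => j; have := sh j; rewrite !mnmDE !exmE !mnm1E /Delta.
  rewrite -!(inj_eq val_inj) /= opredE [_ == i :> nat]eq_sym [j == _ :> nat]eq_sym.
  by move/eqP; rewrite addrA -subr_eq opprK -!PoszD eqz_nat => /eqP ->.
have := sh j; rewrite !mnmDE !exmE !mnm1E /Delta.
rewrite -!(inj_eq val_inj) /= opredE [_ == i :> nat]eq_sym [j == _ :> nat]eq_sym.
by move=> e; rewrite addrA -PoszD -e PoszD addrK.
Qed.

Lemma shifted_pos (n m : nat) (i : 'I_n.+1) (A A' : Exps n m) : (0 < i)%N ->
  shifted i A A' -> (0 < ex A i)%N.
Proof.
move=> i0 /shiftedE /mnmP /(_ i).
by rewrite !mnmDE !exmE !mnm1E eqxx (negPf (opred_neq i0)) addn0 addn1 => <-.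
Qed.

Lemma exists_shifted (n m : nat) (i : 'I_n.+1) (A : Exps n m) :
  (0 < ex A i)%N -> exists A', shifted i A A'.
Proof.
move=> Ai.
have le : (U_(i) <= exm A + U_(opred i))%MM.
  apply/mnm_lepP => j; rewrite mnmDE exmE mnm1E; case: eqP => [<-|//].
  exact: leq_trans Ai (leq_addr _ _).
have [A' eA'] : exists A' : Exps n m, exm A' = (exm A + U_(opred i) - U_(i))%MM.
  apply: exm_surj.
  have /eqP : mdeg (exm A + U_(opred i) - U_(i) + U_(i))%MM = m.+1.
    by rewrite submK // mdegD mdeg_exm mdeg1 addn1.
  by rewrite mdegD mdeg1 addn1 eqSS => /eqP.
by exists A'; apply/shiftedE; rewrite eA' submK.
Qed.

(** A and B have the same degree, so x^B can occur in p x^A only through the constant term of p, and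
    only for A = B. *)
Lemma mcoeffM_mono (K : fieldType) (n m : nat) (p : Spoly K n) (A B : Exps n m) :
  (p * mono K A)@_(exm B) = p@_0%MM * (A == B)%:R.
Proof.
rewrite mono_mpolyX; case: eqVneq => [-> | neAB].
  by rewrite mulr1 -{1}(addm0 (exm B)) mcoeffMX.
rewrite mulr0; apply/eqP; rewrite mcoeff_eq0 (perm_mem (msuppMX _ _)).
apply/negP => /mapP [u _ eB]; case/negP: neAB; apply/eqP/exm_inj.
have /eqP : mdeg (exm B) = (mdeg (exm A) + mdeg u)%N by rewrite eB mdegD.
by rewrite !mdeg_exm -{1}[m]addn0 eqn_add2l eq_sym mdeg_eq0 eB => /eqP ->; rewrite addm0.
Qed.

Lemma mcoeff_mono (K : fieldType) (n m : nat) (A B : Exps n m) :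
  (mono K A)@_(exm B) = (A == B)%:R.
Proof. by rewrite mono_mpolyX mcoeffX (inj_eq (@exm_inj n m)). Qed.

(** * Linear substitutions and the Borel elements that change one variable *)

Lemma eq_lrmorphism (K : fieldType) (n : nat) (f g : {lrmorphism Spoly K n -> Spoly K n}) :
  (forall i, f 'X_i = g 'X_i) -> f =1 g.
Proof.
move=> fg p; rewrite [p]mpolyE !linear_sum; apply: eq_bigr => u _.
rewrite !linearZ; congr (_ *: _); rewrite mpolyXE_id !rmorph_prod.
by apply: eq_bigr => i _; rewrite !rmorphXn /= fg.
Qed.

Definition subst1 (K : fieldType) (n : nat) (j : 'I_n.+1) (y p : Spoly K n) : Spoly K n :=
  comp_mpoly [tuple if i == j then y else 'X_i | i < n.+1] p.

HB.instance Definition _ (K : fieldType) (n : nat) (j : 'I_n.+1) (y : Spoly K n) :=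
  GRing.LRMorphism.copy (subst1 j y)
    (comp_mpoly [tuple if i == j then y else 'X_i | i < n.+1]).

HB.instance Definition _ (K : fieldType) (n : nat) (g : 'M[K]_n.+1) :=
  GRing.LRMorphism.copy (gact g)
    (comp_mpoly [tuple \sum_(j < n.+1) g j i *: 'X_j | i < n.+1]).

Lemma subst1_X (K : fieldType) (n : nat) (j i : 'I_n.+1) (y : Spoly K n) :
  subst1 j y 'X_i = if i == j then y else 'X_i.
Proof. by rewrite /subst1 /= comp_mpolyXU -tnth_nth tnth_mktuple. Qed.

Lemma gact_X (K : fieldType) (n : nat) (g : 'M[K]_n.+1) (i : 'I_n.+1) :
  gact g 'X_i = \sum_(j < n.+1) g j i *: 'X_j.
Proof. by rewrite /gact comp_mpolyXU -tnth_nth tnth_mktuple. Qed.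

(** The part of x^u free of x_j: substitutions for x_j fix it and d/dx_j kills it. *)
Definition cofactor_mono (K : fieldType) (n : nat) (j : 'I_n.+1) (u : 'X_{1..n.+1}) : Spoly K n :=
  \prod_(i < n.+1 | i != j) 'X_i ^+ u i.

Lemma mpolyX_cofactor (K : fieldType) (n : nat) (j : 'I_n.+1) (u : 'X_{1..n.+1}) :
  'X_[u] = 'X_j ^+ u j * cofactor_mono K j u.
Proof. by rewrite mpolyXE_id (bigD1 j). Qed.

Lemma subst1_mpolyX (K : fieldType) (n : nat) (j : 'I_n.+1) (y : Spoly K n) (u : 'X_{1..n.+1}) :
  subst1 j y 'X_[u] = y ^+ u j * cofactor_mono K j u.
Proof.
rewrite (mpolyX_cofactor K j) rmorphM rmorphXn /= subst1_X eqxx; congr (_ * _).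
rewrite rmorph_prod; apply: eq_bigr => i nij.
by rewrite rmorphXn /= subst1_X (negPf nij).
Qed.

Lemma mderiv_cofactor_mono (K : fieldType) (n : nat) (j : 'I_n.+1) (u : 'X_{1..n.+1}) :
  (cofactor_mono K j u)^`M(j) = 0.
Proof.
rewrite /cofactor_mono mprodXnE mderivX mnm_sumE big1 ?scale0r // => i nij.
by rewrite mulmnE mnm1E (negPf nij).
Qed.

(** Column j of a matrix holds the image of x_j under [gact], so replacing that column in the
    identity matrix changes x_j only. *)
Definition colmx (K : fieldType) (n : nat) (j : 'I_n.+1) (v : 'I_n.+1 -> K) : 'M[K]_n.+1 :=
  \matrix_(i, k) if k == j then v i else (i == k)%:R.

Lemma gact_colmx (K : fieldType) (n : nat) (j : 'I_n.+1) (v : 'I_n.+1 -> K) (p : Spoly K n) :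
  gact (colmx j v) p = subst1 j (\sum_(k < n.+1) v k *: 'X_k) p.
Proof.
rewrite /gact /=; congr comp_mpoly; apply: eq_from_tnth => i; rewrite !tnth_mktuple.
case: eqP => [-> | /eqP nij].
  by apply: eq_bigr => k _; rewrite mxE eqxx.
rewrite (bigD1 i) //= mxE (negPf nij) eqxx scale1r big1 ?addr0 // => k nki.
by rewrite mxE (negPf nij) (negPf nki) scale0r.
Qed.

Lemma borel_colmx (K : fieldType) (n : nat) (j : 'I_n.+1) (v : 'I_n.+1 -> K) :
  v j != 0 -> (forall k : 'I_n.+1, (j < k)%N -> v k = 0) -> borel (colmx j v).
Proof.
move=> vj v0.
have tri (i k : 'I_n.+1) : (k < i)%N -> colmx j v i k = 0.
  move=> lki; rewrite mxE; case: eqP lki => [-> /v0 // | _].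
  by case: eqP => // -> ; rewrite ltnn.
(* The transpose is lower triangular, the shape that [det_trig] expects. *)
split=> //; rewrite -unitmx_tr unitmxE det_trig.
  rewrite unitfE; apply/prodf_neq0 => i _; rewrite !mxE eqxx.
  by case: (i =P j) => [-> // | _]; rewrite oner_eq0.
by apply/is_trig_mxP => i k lik; rewrite mxE tri.
Qed.

Lemma sum_delta_X (K : fieldType) (n : nat) (j : 'I_n.+1) (d : K) :
  \sum_(k < n.+1) (if k == j then d else 0) *: 'X_k = d *: 'X_j :> Spoly K n.
Proof. by rewrite (bigD1 j) //= eqxx big1 ?addr0 // => k /negPf ->; rewrite scale0r. Qed.

Lemma subst1_scale_mpolyX (K : fieldType) (n : nat) (j : 'I_n.+1) (d : K) (u : 'X_{1..n.+1}) :
  subst1 j (d *: 'X_j) 'X_[u] = d ^+ u j *: 'X_[u].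
Proof. by rewrite subst1_mpolyX exprZn -scalerAl -mpolyX_cofactor. Qed.

Lemma borel_scale (K : fieldType) (n : nat) (j : 'I_n.+1) (d : K) : d != 0 ->
  exists2 g : 'M[K]_n.+1, borel g & gact g =1 subst1 j (d *: 'X_j).
Proof.
move=> d0; exists (colmx j (fun k => if k == j then d else 0)).
  apply: borel_colmx; first by rewrite eqxx.
  by move=> k; case: eqP => // ->; rewrite ltnn.
by move=> p; rewrite gact_colmx sum_delta_X.
Qed.

(** These elements and the scalings of one variable are the only ones tested on the ideal and on an
    eigenvector. *)
Lemma borel_elementary (K : fieldType) (n : nat) (j : 'I_n.+1) : (0 < j)%N ->
  exists2 g : 'M[K]_n.+1, borel g & gact g =1 subst1 j ('X_j + 'X_(opred j)).
Proof.
move=> j0; have oj := opred_neq j0.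
exists (colmx j (fun k => (k == j)%:R + (k == opred j)%:R)).
  apply: borel_colmx; first by rewrite eqxx [j == opred j]eq_sym (negPf oj) addr0 oner_eq0.
  move=> k ljk; rewrite -!(inj_eq val_inj) /= opredE gtn_eqF // gtn_eqF ?addr0 //.
  exact: leq_ltn_trans (leq_pred _) ljk.
move=> p; rewrite gact_colmx; congr (subst1 j _ p).
rewrite (eq_bigr (fun k : 'I_n.+1 => (if k == j then 1 : K else 0) *: 'X_k +
  (if k == opred j then 1 : K else 0) *: 'X_k)); last first.
  by move=> k _; rewrite -scalerDl; do 2 case: eqP => _.
by rewrite big_split /= !sum_delta_X !scale1r.
Qed.

Definition mnm_cofactor (n : nat) (j : 'I_n.+1) (u : 'X_{1..n.+1}) : 'X_{1..n.+1} :=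
  (\sum_(i < n.+1 | i != j) U_(i) *+ u i)%MM.

Lemma cofactor_monoE (K : fieldType) (n : nat) (j : 'I_n.+1) (u : 'X_{1..n.+1}) :
  cofactor_mono K j u = 'X_[mnm_cofactor j u].
Proof. exact: mprodXnE. Qed.

Lemma mnm_cofactorE (n : nat) (j k : 'I_n.+1) (u : 'X_{1..n.+1}) :
  mnm_cofactor j u k = if k == j then 0 else u k.
Proof.
rewrite mnm_sumE; case: eqP => [-> | /eqP nkj].
  by rewrite big1 // => i nij; rewrite mulmnE mnm1E (negPf nij).
rewrite (bigD1 k) //= mulmnE mnm1E eqxx mul1n big1 ?addn0 // => i /andP [_ nik].
by rewrite mulmnE mnm1E (negPf nik).
Qed.

(** In the binomial expansion of (x_j + x_i)^(u_j) the term taking x_i exactly a times gives x^w;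
    the other terms differ from it in the exponent of x_j. The cases a = 0 and a = 1 give the
    coefficients 1 and u_j. *)
Lemma mcoeff_subst1_elementary (K : fieldType) (n : nat) (i j : 'I_n.+1) (u w : 'X_{1..n.+1})
    (a : nat) : i != j -> (w + U_(j) *+ a = u + U_(i) *+ a)%MM ->
  (subst1 j ('X_j + 'X_i) 'X_[u] : Spoly K n)@_w = 'C(u j, a)%:R.
Proof.
move=> nij e.
have ej : (w j + a)%N = u j.
  by move/mnmP: e => /(_ j); rewrite !mnmDE !mulmnE !mnm1E eqxx (negPf nij) mul1n mul0n addn0.
have lau : (a < (u j).+1)%N by rewrite ltnS -ej leq_addl.
rewrite subst1_mpolyX exprDn mulr_suml raddf_sum (bigD1 (Ordinal lau)) //= big1 ?addr0 => [|b nba];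
  rewrite mulrnAl mcoeffMn cofactor_monoE !mpolyXn -!mpolyXD mcoeffX.
  case: eqP => // /eqP; case/negP; apply/eqP/mnmP => k.
  move/mnmP: e => /(_ k); rewrite !mnmDE !mulmnE !mnm1E mnm_cofactorE.
  by case: (eqVneq j k) => [<-|njk]; rewrite ?eqxx ?(negPf nij) ?(eq_sym k) ?(negPf njk); lia.
case: eqP => [/mnmP /(_ j)|_]; last by rewrite mul0rn.
rewrite !mnmDE !mulmnE !mnm1E mnm_cofactorE eqxx (negPf nij) => ewj.
case/eqP: nba; apply/val_inj => /=; move: (ltn_ord b) ewj ej; lia.
Qed.

(** * Borel-fixed ideals are monomial, and their degree-m monomials form a filter *)

Lemma idealZ (K : fieldType) (n : nat) (I : pred (Spoly K n)) (a : K) (f : Spoly K n) :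
  is_ideal I -> I f -> I (a *: f).
Proof. by case=> _ _ IM If; rewrite -mul_mpolyC; apply: IM. Qed.

(* A torus element scaling one variable by 2 separates two monomials of f, so that
   an element with smaller support and still containing u can be formed. *)
Lemma borel_fixed_monomial (K : fieldType) (n : nat) (I : pred (Spoly K n)) :
  [pchar K] =i pred0 -> is_ideal I -> borel_fixed I ->
  forall (f : Spoly K n) u, I f -> u \in msupp f -> I 'X_[u].
Proof.
move=> K0 idI fixI; have [I0 ID IM] := idI.
have two0 : 2%:R != 0 :> K by move/pcharf0P: K0 => ->.
move=> f; have [k] := ubnP (size (msupp f)); elim: k f => // k IHk f lk u If uf.
case: (altP (@allP _ (pred1 u) (msupp f))) => [allu | /allPn [v vf /= nvu]].
  have ef : f = f@_u *: 'X_[u].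
    rewrite {1}[f]mpolyE (bigD1_seq u) ?msupp_uniq //= big_seq_cond big1 ?addr0 // => v.
    by case/andP=> /allu /= /eqP ->; rewrite eqxx.
  have -> : 'X_[u] = (f@_u)^-1 *: f.
    by rewrite {2}ef scalerA mulVf ?scale1r // -mcoeff_msupp.
  exact: idealZ.
have [i nuvi] : exists i, u i != v i.
  apply/existsP; apply: contraR nvu; rewrite negb_exists => /forallP uv.
  by rewrite eq_sym; apply/eqP/mnmP => i; have := uv i; rewrite negbK => /eqP.
have [g gB gE] := borel_scale i two0.
(* Subtracting 2^(v_i) f kills the coefficient at v, while the one at u survives because u_i and v_i
   differ. *)
pose f' := gact g f - 2%:R ^+ v i *: f.
have cf' w : f'@_w = (2%:R ^+ w i - 2%:R ^+ v i) * f@_w.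
  rewrite mcoeffB mcoeffZ mulrBl gE; congr (_ - _).
  rewrite {1}[f]mpolyE (linear_sum (subst1 i (2%:R *: 'X_i))) (linear_sum (mcoeff w)) /=.
  have [wf | nwf] := boolP (w \in msupp f).
    rewrite (bigD1_seq w wf (msupp_uniq f)) /= big1 => [|w' nww'].
      by rewrite addr0 linearZ /= subst1_scale_mpolyX !mcoeffZ mcoeffX eqxx mulr1 mulrC.
    by rewrite linearZ /= subst1_scale_mpolyX !mcoeffZ mcoeffX (negPf nww') !mulr0.
  rewrite (memN_msupp_eq0 nwf) mulr0 big_seq big1 // => w' w'f.
  rewrite linearZ /= subst1_scale_mpolyX !mcoeffZ mcoeffX; case: eqP => [ew|_].
    by rewrite -ew w'f in nwf.
  by rewrite !mulr0.
have If' : I f'.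
  apply: ID; first by apply/(fixI g gB); exists f.
  by rewrite -scaleNr; apply: idealZ.
apply: (IHk f') => //; last first.
  rewrite mcoeff_msupp cf' mulf_neq0 -?mcoeff_msupp // subr_eq0 -!natrX.
  by rewrite (inj_eq (natr_inj_pchar0 K0)) eqn_exp2l.
have sub : {subset v :: msupp f' <= msupp f}.
  move=> w; rewrite inE => /orP [/eqP -> // |].
  by rewrite !mcoeff_msupp cf'; apply: contraNneq => ->; rewrite mulr0.
have un : uniq (v :: msupp f').
  by rewrite /= msupp_uniq andbT mcoeff_msupp cf' subrr mul0r eqxx.
by rewrite -ltnS; apply: leq_trans lk; rewrite ltnS; exact: (uniq_leq_size un sub).
Qed.

(** The image of x^A under x_i |-> x_i + x_{i-1} contains x^(A + Delta_i) with coefficient a_i,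
    nonzero in characteristic 0; monomials occurring in an element of I lie in I. *)
Lemma Fset_filter (K : fieldType) (n m : nat) (I : pred (Spoly K n)) :
  [pchar K] =i pred0 -> is_ideal I -> borel_fixed I -> is_filter (Fset m I).
Proof.
move=> K0 idI fixI i A A' i0; rewrite !inE => IA sh.
have [g gB gE] := borel_elementary K i0.
rewrite mono_mpolyX; apply: (borel_fixed_monomial K0 idI fixI) (_ : I (gact g (mono K A))) _.
  by apply/(fixI g gB); exists (mono K A).
rewrite mcoeff_msupp gE mono_mpolyX (@mcoeff_subst1_elementary _ _ _ _ _ _ 1%N).
- by rewrite bin1 exmE; move/pcharf0P: K0 => ->; rewrite -lt0n (shifted_pos i0 sh).
- exact: opred_neq.
- by rewrite !mulm1n; apply/shiftedE.
Qed.

(** * The span of the monomials in [F], and the tangent vector as a linear map *)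

(** Membership in the span is an equation in the coefficients of p itself, so that no witness has to
    be carried. *)
Definition mono_span (K : fieldType) (n m : nat) (F : {set Exps n m}) (p : Spoly K n) : Prop :=
  p = \sum_(A in F) p@_(exm A) *: mono K A.

Lemma mono_span_lin (K : fieldType) (n m : nat) (F : {set Exps n m}) (a : K) (p q : Spoly K n) :
  mono_span F p -> mono_span F q -> mono_span F (a *: p + q).
Proof.
rewrite /mono_span => {1}-> {1}->; rewrite scaler_sumr -big_split /=.
by apply: eq_bigr => A _; rewrite mcoeffD mcoeffZ scalerDl scalerA.
Qed.

Lemma mono_span0 (K : fieldType) (n m : nat) (F : {set Exps n m}) : mono_span F (0 : Spoly K n).
Proof. by rewrite /mono_span big1 // => A _; rewrite mcoeff0 scale0r. Qed.

Lemma mono_spanZ (K : fieldType) (n m : nat) (F : {set Exps n m}) (a : K) (p : Spoly K n) :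
  mono_span F p -> mono_span F (a *: p).
Proof. by move=> Fp; rewrite -[_ *: _]addr0; apply: mono_span_lin => //; apply: mono_span0. Qed.

Lemma mono_spanD (K : fieldType) (n m : nat) (F : {set Exps n m}) (p q : Spoly K n) :
  mono_span F p -> mono_span F q -> mono_span F (p + q).
Proof. by rewrite -{2}[p]scale1r; apply: mono_span_lin. Qed.

Lemma mono_span_sum (K : fieldType) (n m : nat) (F : {set Exps n m}) (J : Type) (r : seq J)
    (P : pred J) (f : J -> Spoly K n) :
  (forall j, P j -> mono_span F (f j)) -> mono_span F (\sum_(j <- r | P j) f j).
Proof.
by move=> Ff; elim/big_ind: _ => //; [apply: mono_span0 | apply: mono_spanD].
Qed.

Lemma mono_span_mono (K : fieldType) (n m : nat) (F : {set Exps n m}) (A : Exps n m) :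
  A \in F -> mono_span F (mono K A).
Proof.
move=> FA; rewrite /mono_span (bigD1 A) //= mcoeff_mono eqxx scale1r big1 ?addr0 // => B.
by case/andP=> _ nBA; rewrite mcoeff_mono eq_sym (negPf nBA) scale0r.
Qed.

Lemma mcoeff_mono_span0 (K : fieldType) (n m : nat) (F : {set Exps n m}) (p : Spoly K n) B :
  mono_span F p -> B \notin F -> p@_(exm B) = 0.
Proof.
move=> -> nFB; rewrite linear_sum big1 //= => A FA.
by rewrite mcoeffZ mcoeff_mono; case: eqP => [eAB|_]; rewrite ?mulr0 // -eAB FA in nFB *.
Qed.

(* The homomorphism I_m -> S_m / I_m given by c, extended by 0 outside the span of F and
   lifted to the span of the monomials not in F. *)
Definition tangent_map (K : fieldType) (n m : nat) (F : {set Exps n m})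
    (c : Exps n m -> Exps n m -> K) (p : Spoly K n) : Spoly K n :=
  \sum_(A in F) p@_(exm A) *: \sum_(B in ~: F) c A B *: mono K B.

Lemma tangent_map_is_linear (K : fieldType) (n m : nat) (F : {set Exps n m})
  (c : Exps n m -> Exps n m -> K) : linear (@tangent_map K n m F c).
Proof.
move=> a p q; rewrite /tangent_map scaler_sumr -big_split /=.
by apply: eq_bigr => A _; rewrite mcoeffD mcoeffZ scalerDl scalerA.
Qed.

HB.instance Definition _ (K : fieldType) (n m : nat) (F : {set Exps n m})
  (c : Exps n m -> Exps n m -> K) :=
  GRing.isLinear.Build K (Spoly K n) (Spoly K n) _ (tangent_map F c)
    (tangent_map_is_linear F c).

Lemma tangent_map_mono (K : fieldType) (n m : nat) (F : {set Exps n m})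
    (c : Exps n m -> Exps n m -> K) (A : Exps n m) : A \in F ->
  tangent_map F c (mono K A) = \sum_(B in ~: F) c A B *: mono K B.
Proof.
move=> FA; rewrite /tangent_map (bigD1 A) //= mcoeff_mono eqxx scale1r.
rewrite [X in _ + X]big1 ?addr0 // => B.
by case/andP=> _ nBA; rewrite mcoeff_mono eq_sym (negPf nBA) scale0r.
Qed.

Lemma tangent_map_eq0 (K : fieldType) (n m : nat) (F : {set Exps n m})
    (c : Exps n m -> Exps n m -> K) (p : Spoly K n) :
  (forall A B, A \in F -> c A B != 0 -> p@_(exm A) = 0) -> tangent_map F c p = 0.
Proof.
move=> p0; rewrite /tangent_map big1 // => A FA; rewrite scaler_sumr big1 // => B _.
by have [-> | /(p0 A B FA) ->] := eqVneq (c A B) 0; rewrite ?scale0r ?scaler0.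
Qed.

Lemma mcoeff_tangent_map (K : fieldType) (n m : nat) (F : {set Exps n m})
    (c : Exps n m -> Exps n m -> K) (p : Spoly K n) (B : Exps n m) : B \notin F ->
  (tangent_map F c p)@_(exm B) = \sum_(A in F) p@_(exm A) * c A B.
Proof.
move=> nFB; rewrite linear_sum; apply: eq_bigr => A FA /=.
rewrite mcoeffZ linear_sum (bigD1 B) ?inE //= mcoeffZ mcoeff_mono eqxx mulr1 big1 ?addr0 //.
by move=> B' /andP [_ nBB']; rewrite mcoeffZ mcoeff_mono (negPf nBB') mulr0.
Qed.

Lemma mono_spanT (K : fieldType) (n m : nat) (F : {set Exps n m}) (p : Spoly K n) :
  mono_span F p -> mono_span (setT : {set Exps n m}) p.
Proof. by move=> ->; apply: mono_span_sum => A _; apply/mono_spanZ/mono_span_mono; rewrite inE. Qed.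

Lemma mono_spanT_tangent_map (K : fieldType) (n m : nat) (F : {set Exps n m})
    (c : Exps n m -> Exps n m -> K) (p : Spoly K n) : mono_span (setT : {set Exps n m}) (tangent_map F c p).
Proof.
apply: mono_span_sum => A _; apply/mono_spanZ/mono_span_sum => B _.
by apply/mono_spanZ/mono_span_mono; rewrite inE.
Qed.

(** * Operators commuting with the tangent map up to a scalar *)

(** With phi the tangent map: T preserves the span of [F], and T phi = lam phi T modulo that span. T
    need not be invertible, so derivations are covered as well as substitutions. *)
Definition semi_equivariant (K : fieldType) (n m : nat) (F : {set Exps n m})
    (c : Exps n m -> Exps n m -> K) (lam : K) (T : Spoly K n -> Spoly K n) : Prop :=
  forall p, mono_span F p ->
    mono_span F (T p) /\ mono_span F (T (tangent_map F c p) - lam *: tangent_map F c (T p)).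

Lemma semi_equivariant_mono (K : fieldType) (n m : nat) (F : {set Exps n m})
    (c : Exps n m -> Exps n m -> K) (lam : K) (T : {linear Spoly K n -> Spoly K n}) :
  (forall A, A \in F -> mono_span F (T (mono K A)) /\
     mono_span F (T (tangent_map F c (mono K A)) - lam *: tangent_map F c (T (mono K A)))) ->
  semi_equivariant F c lam T.
Proof.
move=> TF p ->; split.
  rewrite linear_sum; apply: mono_span_sum => A FA; rewrite linearZ; apply: mono_spanZ.
  by case: (TF A FA).
rewrite (linear_sum (tangent_map F c)) !(linear_sum T) (linear_sum (tangent_map F c)) scaler_sumr.
rewrite -sumrB; apply: mono_span_sum => A FA.
rewrite (linearZ_LR (tangent_map F c)) !(linearZ_LR T) (linearZ_LR (tangent_map F c)) /= scalerA [lam * _]mulrC -scalerA -scalerBr; apply: mono_spanZ.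
by case: (TF A FA).
Qed.

(** The condition evaluates T only at forms of degree m. A substitution may therefore be replaced by
    an exponential series truncated at m. *)
Lemma semi_equivariant_eq (K : fieldType) (n m : nat) (F : {set Exps n m})
    (c : Exps n m -> Exps n m -> K) (lam : K) (T T' : Spoly K n -> Spoly K n) :
  (forall p, mono_span (setT : {set Exps n m}) p -> T p = T' p) ->
  semi_equivariant F c lam T -> semi_equivariant F c lam T'.
Proof.
move=> eT TF p Fp; rewrite -(eT _ (mono_spanT Fp)) -(eT _ (mono_spanT_tangent_map F c p)).
exact: TF.
Qed.

Lemma semi_equivariant_id (K : fieldType) (n m : nat) (F : {set Exps n m})
  (c : Exps n m -> Exps n m -> K) : semi_equivariant F c 1 id.
Proof. by move=> p Fp; rewrite scale1r subrr; split=> //; apply: mono_span0. Qed.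

(** The defect of T U at p is T applied to the defect of U at p, plus b times the defect of T at U
    p; T preserves the span of [F]. *)
Lemma semi_equivariant_comp (K : fieldType) (n m : nat) (F : {set Exps n m})
    (c : Exps n m -> Exps n m -> K) (a b : K) (T : {linear Spoly K n -> Spoly K n}) U :
  semi_equivariant F c a T -> semi_equivariant F c b U ->
  semi_equivariant F c (a * b) (T \o U).
Proof.
move=> TF UF p Fp; have [FUp FU] := UF p Fp; have [FTUp FTU] := TF _ FUp.
have [FTw _] := TF _ FU; split=> //=.
have -> : T (U (tangent_map F c p)) - (a * b) *: tangent_map F c (T (U p)) =
    T (U (tangent_map F c p) - b *: tangent_map F c (U p)) +
    b *: (T (tangent_map F c (U p)) - a *: tangent_map F c (T (U p))).
  by rewrite linearB (linearZ_LR T) /= scalerBr scalerA [b * a]mulrC addrA subrK.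
by apply: mono_spanD => //; apply: mono_spanZ.
Qed.

Lemma semi_equivariant_lin (K : fieldType) (n m : nat) (F : {set Exps n m})
    (c : Exps n m -> Exps n m -> K) (lam a : K) T U :
  semi_equivariant F c lam T -> semi_equivariant F c lam U ->
  semi_equivariant F c lam (fun p => a *: T p + U p).
Proof.
move=> TF UF p Fp; have [? FT] := TF p Fp; have [? FU] := UF p Fp.
split; first exact: mono_span_lin.
have -> : a *: T (tangent_map F c p) + U (tangent_map F c p)
    - lam *: tangent_map F c (a *: T p + U p) =
  a *: (T (tangent_map F c p) - lam *: tangent_map F c (T p)) +
    (U (tangent_map F c p) - lam *: tangent_map F c (U p)).
  by rewrite linearP scalerDr opprD addrACA scalerBr !scalerA [lam * a]mulrC.
exact: mono_span_lin.
Qed.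

Lemma semi_equivariant_sum (K : fieldType) (n m : nat) (F : {set Exps n m})
    (c : Exps n m -> Exps n m -> K) (lam : K) (J : Type) (r : seq J) (P : pred J) (a : J -> K)
    (T : J -> Spoly K n -> Spoly K n) :
  (forall j, P j -> semi_equivariant F c lam (T j)) ->
  semi_equivariant F c lam (fun p => \sum_(j <- r | P j) a j *: T j p).
Proof.
move=> TF; elim: r => [|j r IHr].
  apply: (semi_equivariant_eq (T := fun=> 0)) => [p _|p _]; first by rewrite big_nil.
  by rewrite linear0 scaler0 subr0; split; apply: mono_span0.
have [Pj|nPj] := boolP (P j); last first.
  by apply: semi_equivariant_eq IHr => p _; rewrite big_cons (negPf nPj).
by apply: semi_equivariant_eq (semi_equivariant_lin (a j) (TF j Pj) IHr) => p _; rewrite big_cons Pj.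
Qed.

Lemma semi_equivariant_iter (K : fieldType) (n m : nat) (F : {set Exps n m})
    (c : Exps n m -> Exps n m -> K) (T : {linear Spoly K n -> Spoly K n}) k :
  semi_equivariant F c 1 T -> semi_equivariant F c 1 (iter k T).
Proof.
move=> TF; elim: k => [|k IHk]; first exact: semi_equivariant_id.
by have := semi_equivariant_comp TF IHk; rewrite mulr1.
Qed.

(** * The derivations h d/dx_j, their brackets and exponentials *)

Definition der1 (K : fieldType) (n : nat) (h : Spoly K n) (j : 'I_n.+1) (p : Spoly K n) :
  Spoly K n := h * p^`M(j).

Lemma der1_is_linear (K : fieldType) (n : nat) (h : Spoly K n) (j : 'I_n.+1) :
  linear (der1 h j).
Proof. by move=> a p q; rewrite /der1 linearP mulrDr -scalerAr. Qed.

HB.instance Definition _ (K : fieldType) (n : nat) (h : Spoly K n) (j : 'I_n.+1) :=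
  GRing.isLinear.Build K (Spoly K n) (Spoly K n) _ (der1 h j) (der1_is_linear h j).

Lemma mderiv_X (K : fieldType) (n : nat) (i j : 'I_n.+1) :
  ('X_i : Spoly K n)^`M(j) = (i == j)%:R.
Proof.
rewrite mderivX mnm1E; case: eqP => [->|_]; last by rewrite scale0r.
have -> : (U_(j) - U_(j) = 0 :> 'X_{1..n.+1})%MM by apply/mnmP => k; rewrite mnmBE subnn mnm0E.
by rewrite mpolyX0 scale1r.
Qed.

(** The second-order terms of the commutator cancel, and d x_k / dx_j = 0 because k and j differ. *)
Lemma der1_bracket (K : fieldType) (n : nat) (k l j : 'I_n.+1) (p : Spoly K n) : k != j ->
  der1 'X_k j p = der1 'X_k l (der1 'X_l j p) - der1 'X_l j (der1 'X_k l p).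
Proof.
move=> nkj; rewrite /der1 !mderivM !mderiv_X eqxx (negPf nkj) (mderiv_comm l j).
rewrite /= mulr1n mulr0n; ring.
Qed.

Lemma mderiv_mulXn (K : fieldType) (n : nat) (j : 'I_n.+1) (q : Spoly K n) (k : nat) :
  q^`M(j) = 0 -> ('X_j ^+ k * q)^`M(j) = k%:R *: ('X_j ^+ k.-1 * q).
Proof.
move=> q0; rewrite mderivM q0 mulr0 addr0.
suff -> : ('X_j ^+ k : Spoly K n)^`M(j) = k%:R *: 'X_j ^+ k.-1 by rewrite -scalerAl.
elim: k => [|k IHk]; first by rewrite expr0 scale0r -mpolyC1 mderivC.
rewrite exprS mderivM IHk mderiv_X eqxx mul1r -scalerAr /=.
case: k {IHk} => [|k]; first by rewrite scale0r addr0 expr0 scale1r.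
by rewrite /= -exprS -[k.+2]add1n natrD scalerDl scale1r.
Qed.

(** Both h and r behave as constants for d/dx_j, so only the power of x_j is differentiated. For b >
    a the falling factorial is 0, which makes the truncated exponent a - b harmless. *)
Lemma iter_der1 (K : fieldType) (n : nat) (h r : Spoly K n) (j : 'I_n.+1) (a b : nat) :
  h^`M(j) = 0 -> r^`M(j) = 0 ->
  iter b (der1 h j) ('X_j ^+ a * r) = (a ^_ b)%:R *: ('X_j ^+ (a - b) * (h ^+ b * r)).
Proof.
move=> h0 r0; elim: b => [|b IHb]; first by rewrite ffactn0 scale1r subn0 expr0 mul1r.
have hr0 : (h ^+ b * r)^`M(j) = 0.
  rewrite mderivM r0 mulr0 addr0; suff -> : (h ^+ b)^`M(j) = 0 by rewrite mul0r.
  elim: b {IHb} => [|b IHb]; first by rewrite expr0 -mpolyC1 mderivC.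
  by rewrite exprS mderivM IHb h0 mul0r mulr0 addr0.
rewrite iterS IHb (linearZ_LR (der1 h j)) /= [der1 h j _]/der1 mderiv_mulXn // -scalerAr scalerA -natrM ffactnSr.
by rewrite -subn1 -subnDA addn1 mulrCA exprS !mulrA.
Qed.

(** Taylor's formula in x_j: the terms with b > u_j vanish, so the series may be cut at any m >=
    u_j. *)
Lemma subst1_exp_der1 (K : fieldType) (n m : nat) (h : Spoly K n) (j : 'I_n.+1)
    (u : 'X_{1..n.+1}) : [pchar K] =i pred0 -> h^`M(j) = 0 -> (u j <= m)%N ->
  subst1 j ('X_j + h) 'X_[u] = \sum_(b < m.+1) b`!%:R^-1 *: iter b (der1 h j) 'X_[u].
Proof.
move=> K0 h0 lum; rewrite subst1_mpolyX exprDn mulr_suml.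
rewrite (big_ord_widen m.+1 (fun b => (('X_j ^+ (u j - b) * h ^+ b) *+ 'C(u j, b)) *
  cofactor_mono K j u)) ?ltnS // big_mkcond /=; apply: eq_bigr => b _.
rewrite (mpolyX_cofactor K j u) iter_der1 ?mderiv_cofactor_mono // scalerA.
have [_ | lub] := ltnP b (u j).+1; last by rewrite ffact_small // mulr0 scale0r.
rewrite -bin_ffact natrM [_%:R * b`!%:R]mulrC mulKf; last first.
  by move/pcharf0P: K0 => ->; rewrite -lt0n fact_gt0.
by rewrite scaler_nat mulrnAl mulrA.
Qed.

(** Induction on j - k: x_k d/dx_j is the bracket of x_k d/dx_{j-1} and x_{j-1} d/dx_j. *)
Lemma semi_equivariant_der1_lt (K : fieldType) (n m : nat) (F : {set Exps n m})
    (c : Exps n m -> Exps n m -> K) :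
  (forall i : 'I_n.+1, (0 < i)%N -> semi_equivariant F c 1 (der1 'X_(opred i) i)) ->
  forall k j : 'I_n.+1, (k < j)%N -> semi_equivariant F c 1 (der1 'X_k j).
Proof.
move=> H k j; have [d] := ubnP (j - k); elim: d j => // d IHd j ld lkj.
have j0 : (0 < j)%N by apply: leq_ltn_trans lkj.
have [ekj | nkj] := eqVneq k (opred j); first by rewrite ekj; apply: H.
have lkl : (k < opred j)%N.
  by move: nkj; rewrite -(inj_eq val_inj) /= opredE => nkj; lia.
have Hkl : semi_equivariant F c 1 (der1 'X_k (opred j)).
  by apply: IHd => //; rewrite opredE; move: lkl; rewrite opredE; lia.
have Hlj := H j j0.
have C1 := semi_equivariant_comp Hkl Hlj; have C2 := semi_equivariant_comp Hlj Hkl.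
rewrite mul1r in C1 C2.
apply: semi_equivariant_eq (semi_equivariant_lin (-1) C2 C1) => p _ /=.
rewrite scaleN1r addrC -der1_bracket //.
by rewrite -(inj_eq val_inj) /= ltn_eqF.
Qed.

(** The added form h is free of x_j, and h d/dx_j is a combination of the x_k d/dx_j with k < j. On
    forms of degree m the substitution is the exponential of h d/dx_j. *)
Lemma semi_equivariant_subst1_add (K : fieldType) (n m : nat) (F : {set Exps n m})
    (c : Exps n m -> Exps n m -> K) (j : 'I_n.+1) (s : 'I_n.+1 -> K) :
  [pchar K] =i pred0 ->
  (forall i : 'I_n.+1, (0 < i)%N -> semi_equivariant F c 1 (der1 'X_(opred i) i)) ->
  semi_equivariant F c 1 (subst1 j ('X_j + \sum_(k < n.+1 | (k < j)%N) s k *: 'X_k)).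
Proof.
move=> K0 H; set h := \sum_(k < _ | _) _.
have h0 : h^`M(j) = 0.
  rewrite linear_sum big1 //= => k lkj; rewrite mderivZ mderiv_X.
  by rewrite -(inj_eq val_inj) /= (ltn_eqF lkj) scaler0.
have Dh : semi_equivariant F c 1 (der1 h j).
  have := semi_equivariant_sum (P := fun k : 'I_n.+1 => (k < j)%N) (index_enum _) s
    (fun k lkj => semi_equivariant_der1_lt H lkj).
  apply: semi_equivariant_eq => p _; rewrite /der1 /h mulr_suml.
  by apply: eq_bigr => k _; rewrite scalerAl.
have := semi_equivariant_sum (P := predT) (index_enum _) (fun b : 'I_m.+1 => b`!%:R^-1)
  (fun b _ => semi_equivariant_iter b Dh).
apply: semi_equivariant_eq => p ->.
rewrite linear_sum /=.
under eq_bigr => b _.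
  rewrite (_ : iter b _ _ = \sum_(A in [set: Exps n m]) p@_(exm A) *: iter b (der1 h j) (mono K A)).
    rewrite scaler_sumr; over.
  elim: (b : nat) => [//|k IHk]; rewrite iterS IHk linear_sum.
  by apply: eq_bigr => A _; rewrite linearZ_LR.
rewrite exchange_big /=; apply: eq_bigr => A _.
rewrite mono_mpolyX linearZ_LR /= (subst1_exp_der1 (m := m)) //; last first.
  by rewrite exmE -ltnS ltn_ord.
by rewrite scaler_sumr; apply: eq_bigr => b _; rewrite !scalerA mulrC.
Qed.

(** Scaling x_j multiplies x^A by d^(a_j), so conjugation multiplies c_AB by d^(b_j - a_j), the same
    factor d^e for all nonzero entries. *)
Lemma semi_equivariant_subst1_scale (K : fieldType) (n m : nat) (F : {set Exps n m})
    (c : Exps n m -> Exps n m -> K) (j : 'I_n.+1) (d : K) (e : int) : d != 0 ->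
  (forall A B, c A B != 0 -> (ex B j)%:Z - (ex A j)%:Z = e) ->
  semi_equivariant F c (d ^ e) (subst1 j (d *: 'X_j)).
Proof.
move=> d0 ce; apply: semi_equivariant_mono => A FA /=.
have TA B : subst1 j (d *: 'X_j) (mono K B) = d ^+ ex B j *: mono K B.
  by rewrite mono_mpolyX subst1_scale_mpolyX exmE.
rewrite TA; split; first exact/mono_spanZ/mono_span_mono.
rewrite (linearZ_LR (tangent_map F c)) /= tangent_map_mono // (linear_sum (subst1 j _)).
rewrite scalerA scaler_sumr -sumrB big1; first exact: mono_span0.
move=> B _; rewrite linearZ_LR /= TA !scalerA -scalerBl.
have [->|cAB] := eqVneq (c A B) 0; first by rewrite mul0r mulr0 subrr scale0r.
rewrite -(ce A B cAB) [X in _ - X * _](_ : _ = d ^+ ex B j) 1?mulrC ?subrr ?scale0r //.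
by rewrite [LHS]mulrC !exprnP -expfzDr // subrK.
Qed.

(** * Conditions (1) and (2) imply commutation with x_{i-1} d/dx_i *)

Lemma der1_mono (K : fieldType) (n m : nat) (i : 'I_n.+1) (A A' : Exps n m) : (0 < i)%N ->
  shifted i A A' -> der1 'X_(opred i) i (mono K A) = (ex A i)%:R *: mono K A'.
Proof.
move=> i0 sh; rewrite /der1 !mono_mpolyX mderivX exmE -scalerAr -mpolyXD; congr (_ *: 'X_[_]).
apply: (@addIm _ U_(i)%MM); rewrite -addmA submK; first by rewrite addmC; apply/esym/shiftedE.
apply/mnm_lepP => j; rewrite mnm1E exmE; case: eqP => // <-; exact: shifted_pos sh.
Qed.

Lemma der1_mono0 (K : fieldType) (n m : nat) (i : 'I_n.+1) (h : Spoly K n) (A : Exps n m) :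
  ex A i = 0%N -> der1 h i (mono K A) = 0.
Proof. by move=> Ai; rewrite /der1 mono_mpolyX mderivX exmE Ai scale0r mulr0. Qed.

(** A matrix with this property has at most one nonzero entry in each row and in each column. *)
Definition has_weight (K : fieldType) (n m : nat) (c : Exps n m -> Exps n m -> K)
    (Kv : 'I_n.+1 -> int) : Prop :=
  forall A B, c A B != 0 -> forall j, (ex B j)%:Z - (ex A j)%:Z = Kv j.

Lemma has_weight_shifted (K : fieldType) (n m : nat) (c : Exps n m -> Exps n m -> K) Kv
    (i : 'I_n.+1) (A B A' B' : Exps n m) : has_weight c Kv ->
  c A B != 0 -> c A' B' != 0 -> shifted i A A' <-> shifted i B B'.
Proof.
by move=> w /w wAB /w wAB'; split=> sh j; have := sh j; move: (wAB j) (wAB' j); lia.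
Qed.

Lemma exP (n m : nat) (A B : Exps n m) : (forall j, ex A j = ex B j) -> A = B.
Proof. by move=> eAB; apply/exm_inj/mnmP => j; rewrite !exmE. Qed.

Lemma has_weight_injr (K : fieldType) (n m : nat) (c : Exps n m -> Exps n m -> K) Kv
  (A B B' : Exps n m) : has_weight c Kv -> c A B != 0 -> c A B' != 0 -> B = B'.
Proof. by move=> w /w wB /w wB'; apply: exP => j; move: (wB j) (wB' j); lia. Qed.

Lemma has_weight_injl (K : fieldType) (n m : nat) (c : Exps n m -> Exps n m -> K) Kv
  (A A' B : Exps n m) : has_weight c Kv -> c A B != 0 -> c A' B != 0 -> A = A'.
Proof. by move=> w /w wA /w wA'; apply: exP => j; move: (wA j) (wA' j); lia. Qed.

Lemma shifted_inj (n m : nat) (i : 'I_n.+1) (A B B' : Exps n m) :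
  shifted i A B -> shifted i A B' -> B = B'.
Proof. by move=> s s'; apply: exP => j; move: (s j) (s' j); lia. Qed.

(** On x^A with c_AB nonzero, the two composites give b_i c_AB x^(B + Delta_i) and a_i c_A'B' x^(B +
    Delta_i). The last three hypotheses are the filter property of [F'], that of [F''], and the
    ratio condition without denominators. *)
Lemma semi_equivariant_der1_opred (K : fieldType) (n m : nat) (F : {set Exps n m})
    (c : Exps n m -> Exps n m -> K) (Kv : 'I_n.+1 -> int) (i : 'I_n.+1) :
  (0 < i)%N -> is_filter F -> has_weight c Kv ->
  (forall A B, c A B != 0 -> A \in F /\ B \notin F) ->
  (forall A A', A \in F -> (forall B, c A B = 0) -> shifted i A A' -> forall B, c A' B = 0) ->
  (forall A B B', c A B != 0 -> shifted i B B' -> B' \notin F -> exists A', c A' B' != 0) ->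
  (forall A B A' B', c A B != 0 -> c A' B' != 0 -> shifted i A A' -> shifted i B B' ->
     (ex A i)%:R * c A' B' = (ex B i)%:R * c A B) ->
  semi_equivariant F c 1 (der1 'X_(opred i) i).
Proof.
move=> i0 filF w supp cF' cF'' cE; apply: semi_equivariant_mono => A FA /=.
have phi0 A1 : (forall B, c A1 B = 0) -> tangent_map F c (mono K A1) = 0.
  move=> cA1; apply: tangent_map_eq0 => A2 B _ cA2; rewrite mcoeff_mono; case: eqP => // eA.
  by rewrite -eA cA1 eqxx in cA2.
have phi1 A1 B1 : c A1 B1 != 0 -> tangent_map F c (mono K A1) = c A1 B1 *: mono K B1.
  move=> cAB; have [FA1 nFB1] := supp _ _ cAB.
  rewrite tangent_map_mono // (bigD1 B1) ?inE //= big1 ?addr0 // => B2 /andP [_ nB].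
  have [-> | cAB2] := eqVneq (c A1 B2) 0; first by rewrite scale0r.
  by rewrite (has_weight_injr w cAB cAB2) eqxx in nB.
split.
  have [/(@exists_shifted n m) [A' sh] | ] := ltnP 0 (ex A i).
    by rewrite (der1_mono K i0 sh); apply/mono_spanZ/mono_span_mono/(filF i A).
  by rewrite leqn0 => /eqP /der1_mono0 ->; apply: mono_span0.
rewrite scale1r.
have [[B cAB] | cA0] : (exists B, c A B != 0) \/ (forall B, c A B = 0).
- case: (boolP [exists B, c A B != 0]) => [/existsP | ]; first by left.
  by rewrite negb_exists => /forallP cA; right => B; apply/eqP; rewrite -[_ == _]negbK.
- rewrite (phi1 _ _ cAB) linearZ_LR /=.
  have [/(@exists_shifted n m) [A' shA] | ] := ltnP 0 (ex A i); last first.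
    (* Here a_i = 0. If B + Delta_i were outside [F], its column would be nonzero, in a row A +
       Delta_i that does not exist. *)
    rewrite leqn0 => /eqP A0; rewrite (der1_mono0 _ A0) linear0 subr0; apply: mono_spanZ.
    have [/(@exists_shifted n m) [B' shB] | ] := ltnP 0 (ex B i); last first.
      by rewrite leqn0 => /eqP /der1_mono0 ->; apply: mono_span0.
    rewrite (der1_mono K i0 shB); apply/mono_spanZ/mono_span_mono.
    apply: contraT => /(cF'' _ _ _ cAB shB) [A' cAB'].
    by have := shifted_pos i0 ((has_weight_shifted i w cAB cAB').2 shB); rewrite A0.
  rewrite (der1_mono K i0 shA) linearZ_LR /=.
  have [/(@exists_shifted n m) [B' shB] | ] := ltnP 0 (ex B i); last first.
    (* Here b_i = 0: a nonzero entry in row A' would lie in column B + Delta_i, which does not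
       exist. *)
    rewrite leqn0 => /eqP B0; rewrite (der1_mono0 _ B0) scaler0 phi0.
      by rewrite scaler0 subr0; apply: mono_span0.
    move=> B'; apply/eqP; apply: contraT => cAB'.
    by have := shifted_pos i0 ((has_weight_shifted i w cAB cAB').1 shA); rewrite B0.
  rewrite (der1_mono K i0 shB).
  have [FB' | nFB'] := boolP (B' \in F).
    (* The only column allowed in row A' is B', which lies in [F]; so row A' vanishes, and x^B' is 0
       modulo the span. *)
    rewrite phi0 => [|B1]; first by rewrite scaler0 subr0; do 2 apply: mono_spanZ; apply: mono_span_mono.
    apply/eqP; apply: contraT => cAB1.
    have sB1 := (has_weight_shifted i w cAB cAB1).1 shA.
    by have [_] := supp _ _ cAB1; rewrite -(shifted_inj shB sB1) FB'.
  (* Column B' is nonzero, and by the weight its nonzero entry sits in row A'. *)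
  have [A1 cA1] := cF'' _ _ _ cAB shB nFB'.
  have sA1 := (has_weight_shifted i w cAB cA1).2 shB.
  rewrite -(shifted_inj shA sA1) in cA1.
  rewrite (phi1 _ _ cA1) !scalerA (cE _ _ _ _ cAB cA1 shA shB) mulrC subrr.
  exact: mono_span0.
rewrite (phi0 A cA0) linear0 sub0r -scaleN1r; apply: mono_spanZ.
have [/(@exists_shifted n m) [A' sh] | ] := ltnP 0 (ex A i).
  by rewrite (der1_mono K i0 sh) linearZ_LR /= (phi0 _ (cF' _ _ FA cA0 sh)) scaler0; apply: mono_span0.
by rewrite leqn0 => /eqP /der1_mono0 ->; rewrite linear0; apply: mono_span0.
Qed.

(** * Upper-triangular matrices as composites of substitutions for one variable *)

(* Carrying an inverse along avoids having to show that T^-1 is again given by a matrix. *)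
Definition semi_equivariant_iso (K : fieldType) (n m : nat) (F : {set Exps n m})
    (c : Exps n m -> Exps n m -> K) (T : Spoly K n -> Spoly K n) : Prop :=
  exists (U U' : {lrmorphism Spoly K n -> Spoly K n}) (a b : K),
    [/\ T =1 U, cancel U' U, semi_equivariant F c a U & semi_equivariant F c b U'].

Lemma semi_equivariant_iso_comp (K : fieldType) (n m : nat) (F : {set Exps n m})
    (c : Exps n m -> Exps n m -> K) (T T1 T2 : Spoly K n -> Spoly K n) :
  T =1 T1 \o T2 -> semi_equivariant_iso F c T1 -> semi_equivariant_iso F c T2 ->
  semi_equivariant_iso F c T.
Proof.
move=> eT [U1 [V1 [a1 [b1 [e1 K1 F1 G1]]]]] [U2 [V2 [a2 [b2 [e2 K2 F2 G2]]]]].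
exists (U1 \o U2 : {lrmorphism _ -> _}), (V2 \o V1 : {lrmorphism _ -> _}), (a1 * a2), (b2 * b1).
split; [by move=> p; rewrite eT /= e2 e1 | by move=> p /=; rewrite K2 K1 | |];
  exact: semi_equivariant_comp.
Qed.

Lemma subst1_comp_id (K : fieldType) (n : nat) (j : 'I_n.+1) (y z : Spoly K n) :
  subst1 j y z = 'X_j -> cancel (subst1 j z) (subst1 j y).
Proof.
move=> yz p; rewrite -[RHS]/((idfun : {lrmorphism Spoly K n -> Spoly K n}) p).
rewrite -[LHS]/((subst1 j y \o subst1 j z : {lrmorphism Spoly K n -> Spoly K n}) p).
apply: eq_lrmorphism => i /=; rewrite subst1_X; case: eqP => [-> // | /eqP nij].
by rewrite subst1_X (negPf nij).
Qed.

Lemma subst1_sum_lt (K : fieldType) (n : nat) (j : 'I_n.+1) (y : Spoly K n) (s : 'I_n.+1 -> K) :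
  subst1 j y (\sum_(k < n.+1 | (k < j)%N) s k *: 'X_k) = \sum_(k < n.+1 | (k < j)%N) s k *: 'X_k.
Proof.
rewrite (linear_sum (subst1 j y)); apply: eq_bigr => k lkj.
by rewrite linearZ_LR /= subst1_X -(inj_eq val_inj) /= (ltn_eqF lkj).
Qed.

(** The image of x_j is s_j (x_j + h) with h in the span of the x_k, k < j. So the map is a scaling
    followed by x_j |-> x_j + h, with inverses given by 1 / s_j and -h. *)
Lemma semi_equivariant_iso_subst1 (K : fieldType) (n m : nat) (F : {set Exps n m})
    (c : Exps n m -> Exps n m -> K) (Kv : 'I_n.+1 -> int) (j : 'I_n.+1) (s : 'I_n.+1 -> K) :
  [pchar K] =i pred0 -> has_weight c Kv ->
  (forall i : 'I_n.+1, (0 < i)%N -> semi_equivariant F c 1 (der1 'X_(opred i) i)) ->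
  s j != 0 -> (forall k : 'I_n.+1, (j < k)%N -> s k = 0) ->
  semi_equivariant_iso F c (subst1 j (\sum_(k < n.+1) s k *: 'X_k)).
Proof.
move=> K0 w H sj0 s0; pose s' k := s k / s j.
apply: (@semi_equivariant_iso_comp _ _ _ _ _ _
  (subst1 j ('X_j + \sum_(k < n.+1 | (k < j)%N) s' k *: 'X_k)) (subst1 j (s j *: 'X_j))).
- move=> p; rewrite -[RHS]/((subst1 j ('X_j + \sum_(k < n.+1 | (k < j)%N) s' k *: 'X_k)
    \o subst1 j (s j *: 'X_j) : {lrmorphism Spoly K n -> Spoly K n}) p).
  apply: eq_lrmorphism => i /=; rewrite !subst1_X; case: eqP => [_ | /eqP nij]; last first.
    by rewrite subst1_X (negPf nij).
  rewrite linearZ_LR /= subst1_X eqxx scalerDr (bigD1 j) //=; congr (_ + _).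
  rewrite scaler_sumr big_mkcond [RHS]big_mkcond /=; apply: eq_bigr => k _.
  rewrite -(inj_eq val_inj) /=; case: ltngtP => [lkj|ljk|//].
    by rewrite scalerA mulrCA divff // mulr1.
  by rewrite s0 // scale0r.
- exists (subst1 j ('X_j + \sum_(k < n.+1 | (k < j)%N) s' k *: 'X_k)).
  exists (subst1 j ('X_j + \sum_(k < n.+1 | (k < j)%N) (- s' k) *: 'X_k)), 1, 1.
  split=> //; try exact: semi_equivariant_subst1_add.
  apply: subst1_comp_id; rewrite linearD /= subst1_sum_lt subst1_X eqxx -addrA -big_split /=.
  by rewrite big1 ?addr0 // => k _; rewrite scaleNr subrr.
- exists (subst1 j (s j *: 'X_j)), (subst1 j ((s j)^-1 *: 'X_j)), (s j ^ Kv j), ((s j)^-1 ^ Kv j).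
  split=> //; try by apply: semi_equivariant_subst1_scale; rewrite ?invr_eq0 // => A B /w.
  by apply: subst1_comp_id; rewrite linearZ_LR /= subst1_X eqxx scalerA mulVf // scale1r.
Qed.

Lemma borel_diag (K : fieldType) (n : nat) (g : 'M[K]_n.+1) (j : 'I_n.+1) : borel g -> g j j != 0.
Proof.
case=> gU g0; move: gU; rewrite -unitmx_tr unitmxE det_trig.
  by rewrite unitfE => /prodf_neq0 /(_ j isT); rewrite mxE.
by apply/is_trig_mxP => i k lik; rewrite mxE g0.
Qed.

(** Interpolates between the identity at k = 0 and [gact g] at k = n + 1, one variable at a time. *)
Definition gact_lt (K : fieldType) (n : nat) (g : 'M[K]_n.+1) (k : nat) (p : Spoly K n) :
  Spoly K n := comp_mpoly [tuple if (i < k)%N then gact g 'X_i else 'X_i | i < n.+1] p.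

HB.instance Definition _ (K : fieldType) (n : nat) (g : 'M[K]_n.+1) (k : nat) :=
  GRing.LRMorphism.copy (gact_lt g k)
    (comp_mpoly [tuple if (i < k)%N then gact g 'X_i else 'X_i | i < n.+1]).

Lemma gact_lt_X (K : fieldType) (n : nat) (g : 'M[K]_n.+1) (k : nat) (i : 'I_n.+1) :
  gact_lt g k 'X_i = if (i < k)%N then gact g 'X_i else 'X_i.
Proof. by rewrite /gact_lt /= comp_mpolyXU -tnth_nth tnth_mktuple. Qed.

Lemma semi_equivariant_iso_gact (K : fieldType) (n m : nat) (F : {set Exps n m})
    (c : Exps n m -> Exps n m -> K) (Kv : 'I_n.+1 -> int) (g : 'M[K]_n.+1) :
  [pchar K] =i pred0 -> has_weight c Kv ->
  (forall i : 'I_n.+1, (0 < i)%N -> semi_equivariant F c 1 (der1 'X_(opred i) i)) ->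
  borel g -> semi_equivariant_iso F c (gact g).
Proof.
move=> K0 w H gB; have [gU g0] := gB.
suff step k : (k <= n.+1)%N -> semi_equivariant_iso F c (gact_lt g k).
  have [U [U' [a [b [eU UK FU FU']]]]] := step n.+1 (leqnn _).
  exists U, U', a, b; split=> // p; rewrite -eU; apply: (@eq_lrmorphism _ _ (gact g) (gact_lt g n.+1)) => i /=.
  by rewrite gact_lt_X ltn_ord.
elim: k => [_ | k IHk lk].
  exists idfun, idfun, 1, 1; split=> //; try exact: semi_equivariant_id.
  by apply: (@eq_lrmorphism _ _ (gact_lt g 0) idfun) => i /=; rewrite gact_lt_X.
pose j := Ordinal lk.
apply: semi_equivariant_iso_comp (IHk (ltnW lk)); last first.
  apply: (semi_equivariant_iso_subst1 (s := fun l => g l j)) w H _ _ => //; first exact: borel_diag.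
  by move=> l; apply: g0.
move=> p; rewrite -gact_X.
rewrite -[RHS]/((subst1 j (gact g 'X_j) \o gact_lt g k : {lrmorphism Spoly K n -> Spoly K n}) p).
apply: eq_lrmorphism => i /=; rewrite !gact_lt_X ltnS leq_eqVlt.
have [eik | nik] := eqVneq (i : nat) k.
  by have -> : i = j by [apply/val_inj]; rewrite /= ltnn subst1_X eqxx.
have nij : i != j by rewrite -(inj_eq val_inj).
case: ltnP => [lik | lki] /=; last by rewrite subst1_X (negPf nij).
(* For i < k the form g x_i does not involve x_k, by triangularity, so the later substitution for
   x_k leaves it alone. *)
rewrite !gact_X (linear_sum (subst1 j _)); apply: eq_bigr => l _.
rewrite linearZ_LR /= subst1_X; case: eqP => [-> | //].
by rewrite g0 // !scale0r.
Qed.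

(** * From operators to their action on deformation ideals *)

(** For F = [Fset m I] this is convertible to [defo_ideal I c]; the arguments below depend on the
    set [F] only. *)
Definition defo_gen (K : fieldType) (n m : nat) (F : {set Exps n m})
    (c : Exps n m -> Exps n m -> K) : DS K n -> Prop :=
  gen_ideal F (@mono K n m) (fun A => \sum_(B in ~: F) c A B *: mono K B).

Lemma gen_idealD (K : fieldType) (n m : nat) (F : {set Exps n m}) u v (a b a' b' : Spoly K n) :
  gen_ideal F u v (a, b) -> gen_ideal F u v (a', b') -> gen_ideal F u v (a + a', b + b').
Proof.
case=> p [q [/= -> ->]] [p' [q' [/= -> ->]]].
exists (fun A => p A + p' A), (fun A => q A + q' A) => /=; split; rewrite -big_split /=;
  by apply: eq_bigr => A _; ring.
Qed.

Lemma gen_idealM (K : fieldType) (n m : nat) (F : {set Exps n m}) u v (r a b : Spoly K n) :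
  gen_ideal F u v (a, b) -> gen_ideal F u v (r * a, r * b).
Proof.
case=> p [q [/= -> ->]]; exists (fun A => r * p A), (fun A => r * q A) => /=.
by rewrite !mulr_sumr; split; apply: eq_bigr => A _; ring.
Qed.

Lemma gen_ideal_sum (K : fieldType) (n m : nat) (F : {set Exps n m}) u v (J : finType)
    (G : {set J}) (a b : J -> Spoly K n) :
  (forall j, j \in G -> gen_ideal F u v (a j, b j)) ->
  gen_ideal F u v (\sum_(j in G) a j, \sum_(j in G) b j).
Proof.
move=> Jab; apply: (big_ind2 (fun x y => gen_ideal F u v (x, y))) => //.
  by exists (fun=> 0), (fun=> 0); split; rewrite big1 // => A _; rewrite !mul0r ?addr0.
by move=> *; apply: gen_idealD.
Qed.

Lemma defo_gen_tangent_map (K : fieldType) (n m : nat) (F : {set Exps n m})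
    (c : Exps n m -> Exps n m -> K) (p : Spoly K n) :
  mono_span F p -> defo_gen F c (p, tangent_map F c p).
Proof.
move=> Fp; exists (fun A => (p@_(exm A))%:MP), (fun=> 0) => /=; split.
  by rewrite {1}Fp; apply: eq_bigr => A _; rewrite mul_mpolyC.
by apply: eq_bigr => A _; rewrite mul_mpolyC mul0r addr0.
Qed.

(** Multiplying a generator by eps removes its first-order term. *)
Lemma defo_gen_eps (K : fieldType) (n m : nat) (F : {set Exps n m})
    (c : Exps n m -> Exps n m -> K) (p : Spoly K n) : mono_span F p -> defo_gen F c (0, p).
Proof.
move=> Fp; exists (fun=> 0), (fun A => (p@_(exm A))%:MP) => /=; split.
  by rewrite big1 // => A _; rewrite mul0r.
by rewrite {1}Fp; apply: eq_bigr => A _; rewrite mul_mpolyC mul0r add0r.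
Qed.

Lemma tangent_mapZ (K : fieldType) (n m : nat) (F : {set Exps n m})
    (a : K) (c c' : Exps n m -> Exps n m -> K) (p : Spoly K n) :
  (forall A B, c' A B = a * c A B) -> tangent_map F c' p = a *: tangent_map F c p.
Proof.
move=> ec; rewrite /tangent_map scaler_sumr; apply: eq_bigr => A _.
rewrite scalerA mulrC -scalerA; congr (_ *: _); rewrite scaler_sumr.
by apply: eq_bigr => B _; rewrite ec scalerA.
Qed.

(** With phi, phi' the maps of c, c', the image of x^A + eps phi(x^A) is T x^A + eps phi'(T x^A)
    plus eps times an element of the span of [F]; both summands lie in the ideal of c'. *)
Lemma defo_gen_image (K : fieldType) (n m : nat) (F : {set Exps n m})
    (c c' : Exps n m -> Exps n m -> K) (T : {lrmorphism Spoly K n -> Spoly K n}) x :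
  (forall p, mono_span F p ->
     mono_span F (T p) /\ mono_span F (T (tangent_map F c p) - tangent_map F c' (T p))) ->
  defo_gen F c x -> defo_gen F c' (T x.1, T x.2).
Proof.
move=> TF [p [q [-> ->]]]; rewrite !(linear_sum T); apply: gen_ideal_sum => A FA /=.
have [FT Fw] := TF _ (mono_span_mono K FA).
have -> : T (p A * mono K A) = T (p A) * (T (mono K A) + 0) + T (q A) * 0.
  by rewrite mulr0 !addr0 rmorphM.
have -> : T (p A * (\sum_(B in ~: F) c A B *: mono K B) + q A * mono K A) =
    T (p A) * (tangent_map F c' (T (mono K A)) +
      (T (tangent_map F c (mono K A)) - tangent_map F c' (T (mono K A)))) +
    T (q A) * T (mono K A).
  by rewrite tangent_map_mono // rmorphD !rmorphM /= [tangent_map _ _ _ + (_ - _)]addrC subrK.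
apply: gen_idealD; apply: gen_idealM; last exact: defo_gen_eps.
by apply: gen_idealD; [apply: defo_gen_tangent_map | apply: defo_gen_eps].
Qed.

Lemma semi_equivariant_iso_act (K : fieldType) (n m : nat) (F : {set Exps n m})
    (c : Exps n m -> Exps n m -> K) (g : 'M[K]_n.+1) :
  (forall A B, c A B != 0 -> A \in F /\ B \notin F) -> (exists A B, c A B != 0) ->
  semi_equivariant_iso F c (gact g) ->
  exists lam : K, forall x, gimage g (defo_gen F c) x <-> defo_gen F (fun A B => lam * c A B) x.
Proof.
move=> supp [A [B cAB]] [U [U' [a [b [eU UK FU FU']]]]].
(* The composite of U' and U is the identity with multiplier a b; a nonzero entry of c forces that
   multiplier to be 1. *)
have ab : a * b = 1.
  have [FA nFB] := supp _ _ cAB.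
  have [_] := semi_equivariant_comp FU FU' (mono_span_mono K FA).
  rewrite /= !UK tangent_map_mono // => /mcoeff_mono_span0 /(_ nFB).
  rewrite mcoeffB mcoeffZ -(tangent_map_mono c FA) mcoeff_tangent_map // (bigD1 A) //=.
  rewrite mcoeff_mono eqxx mul1r big1 ?addr0 => [|A1 /andP [_ nA]]; last first.
    by rewrite mcoeff_mono eq_sym (negPf nA) mul0r.
  rewrite -{1}[c A B]mul1r -mulrBl => /eqP; rewrite mulf_eq0 (negPf cAB) orbF subr_eq0.
  by move/eqP.
exists a => x; split=> [[y [Jy ->]] | Jx].
  rewrite !eU; apply: (defo_gen_image (c := c)) Jy => p Fp; have [? Fw] := FU p Fp.
  by split=> //; rewrite (tangent_mapZ _ _ (fun A B => erefl (a * c A B))).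
exists (U' x.1, U' x.2); split; last by rewrite /= !eU !UK; case: (x).
apply: defo_gen_image Jx => p Fp; have [? Fw] := FU' p Fp; split=> //.
rewrite (tangent_mapZ _ _ (fun A B => erefl (a * c A B))) linearZ_LR /=.
(* U' contributes the factor b, which takes a phi back to phi. *)
by rewrite -[tangent_map _ _ (U' p)]scale1r -ab -scalerA -scalerBr; apply: mono_spanZ.
Qed.

(** * Coefficient identities satisfied by an eigenvector *)

(** Both sides are the coefficient of x^B in the eps-part of g(x^A + eps phi(x^A)). Writing this
    element in the generators for c', its eps-free part fixes the constant terms of the multipliers,
    and only these contribute at x^B. *)
Lemma gimage_sub_mcoeff (K : fieldType) (n m : nat) (F : {set Exps n m})
    (c c' : Exps n m -> Exps n m -> K) (g : 'M[K]_n.+1) (A B : Exps n m) :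
  (forall x, gimage g (defo_gen F c) x -> defo_gen F c' x) -> A \in F -> B \notin F ->
  \sum_(B0 in ~: F) c A B0 * (gact g (mono K B0))@_(exm B) =
  \sum_(A0 in F) (gact g (mono K A))@_(exm A0) * c' A0 B.
Proof.
move=> gJ FA nFB.
have [|p [q [/= e1 e2]]] := gJ (gact g (mono K A), gact g (tangent_map F c (mono K A))).
  by eexists; split; first exact: defo_gen_tangent_map (mono_span_mono K FA).
have e1' A0 : A0 \in F -> (gact g (mono K A))@_(exm A0) = (p A0)@_0%MM.
  move=> FA0; rewrite e1 (linear_sum (mcoeff _)) (bigD1 A0) //= mcoeffM_mono eqxx mulr1.
  by rewrite big1 ?addr0 // => A1 /andP [_ nA]; rewrite mcoeffM_mono (negPf nA) mulr0.
transitivity (gact g (tangent_map F c (mono K A)))@_(exm B).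
  rewrite tangent_map_mono // (linear_sum (gact g)) (linear_sum (mcoeff _)).
  by apply: eq_bigr => B0 _; rewrite linearZ_LR /= mcoeffZ.
rewrite e2 (linear_sum (mcoeff _)); apply: eq_bigr => A1 FA1; rewrite e1' //= mcoeffD mcoeffM_mono.
have -> : (A1 == B) = false by apply/eqP => e; rewrite -e FA1 in nFB.
rewrite mulr0 addr0 mulr_sumr (linear_sum (mcoeff _)) (bigD1 B) ?inE //= -scalerAr mcoeffZ.
rewrite mcoeffM_mono eqxx mulr1 big1 ?addr0 => [|B1 /andP [_ nB]]; first by rewrite mulrC.
by rewrite -scalerAr mcoeffZ mcoeffM_mono (negPf nB) !mulr0.
Qed.

Lemma has_weight_suml (K : fieldType) (n m : nat) (F : {set Exps n m})
    (c : Exps n m -> Exps n m -> K) Kv (f : Exps n m -> K) (A B : Exps n m) :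
  has_weight c Kv -> c A B != 0 -> B \notin F ->
  \sum_(B0 in ~: F) c A B0 * f B0 = c A B * f B.
Proof.
move=> w cAB nFB; rewrite (bigD1 B) ?inE //= big1 ?addr0 // => B0 /andP [_ nB].
have [-> | cAB0] := eqVneq (c A B0) 0; first by rewrite mul0r.
by rewrite (has_weight_injr w cAB cAB0) eqxx in nB.
Qed.

Lemma has_weight_sumr (K : fieldType) (n m : nat) (F : {set Exps n m})
    (c : Exps n m -> Exps n m -> K) Kv (f : Exps n m -> K) (A B : Exps n m) :
  has_weight c Kv -> c A B != 0 -> A \in F ->
  \sum_(A0 in F) f A0 * c A0 B = f A * c A B.
Proof.
move=> w cAB FA; rewrite (bigD1 A) //= big1 ?addr0 // => A0 /andP [_ nA].
have [-> | cA0B] := eqVneq (c A0 B) 0; first by rewrite mulr0.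
by rewrite (has_weight_injl w cAB cA0B) eqxx in nA.
Qed.

(** The matrix form of g phi = lam phi g modulo the span of [F]. *)
Definition eigen_identity (K : fieldType) (n m : nat) (F : {set Exps n m})
    (c : Exps n m -> Exps n m -> K) (g : 'M[K]_n.+1) (lam : K) : Prop :=
  forall A B, A \in F -> B \notin F ->
  \sum_(B0 in ~: F) c A B0 * (gact g (mono K B0))@_(exm B) =
  lam * \sum_(A0 in F) (gact g (mono K A))@_(exm A0) * c A0 B.

(** Scaling x_j by 2 gives 2^(b_j) = lam 2^(a_j) at every nonzero entry. Comparison with the entry
    (A0, B0) eliminates lam, and in characteristic 0 powers of 2 determine their exponents. *)
Lemma eigen_has_weight (K : fieldType) (n m : nat) (F : {set Exps n m})
    (c : Exps n m -> Exps n m -> K) (A0 B0 : Exps n m) : [pchar K] =i pred0 ->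
  (forall A B, c A B != 0 -> A \in F /\ B \notin F) ->
  (forall g, borel g -> exists lam, eigen_identity F c g lam) -> c A0 B0 != 0 ->
  has_weight c (fun j => (ex B0 j)%:Z - (ex A0 j)%:Z).
Proof.
move=> K0 supp eig cAB0 A B cAB j.
have two0 : 2%:R != 0 :> K by move/pcharf0P: K0 => ->.
have [g gB gE] := borel_scale j two0; have [lam gid] := eig g gB.
have key A1 B1 : c A1 B1 != 0 -> 2%:R ^+ ex B1 j = lam * 2%:R ^+ ex A1 j :> K.
  move=> cAB1; have [FA1 nFB1] := supp _ _ cAB1; have := gid A1 B1 FA1 nFB1.
  have gm A2 B2 : (gact g (mono K A2))@_(exm B2) = 2%:R ^+ ex A2 j * (A2 == B2)%:R.
    by rewrite gE mono_mpolyX subst1_scale_mpolyX mcoeffZ exmE -mono_mpolyX mcoeff_mono.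
  rewrite (bigD1 B1) ?inE //= big1 ?addr0 => [|B2 /andP [_ nB]]; last first.
    by rewrite gm (negPf nB) !mulr0.
  rewrite (bigD1 A1) //= big1 ?addr0 => [|A2 /andP [_ nA]]; last first.
    by rewrite gm eq_sym (negPf nA) mulr0 mul0r.
  by rewrite !gm !eqxx !mulr1 mulrC mulrA => /(mulIf cAB1).
have : 2%:R ^+ (ex B j + ex A0 j) = 2%:R ^+ (ex B0 j + ex A j) :> K.
  by rewrite !exprD (key _ _ cAB) (key _ _ cAB0); ring.
rewrite -!natrX => /(natr_inj_pchar0 K0) /eqP; rewrite eqn_exp2l // => /eqP; lia.
Qed.

(* M is the matrix of x_i |-> x_i + x_{i-1}; its diagonal entries are 1, which forces the
   eigenvalue of this unipotent element to be 1. *)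
Lemma eigen_der_identity (K : fieldType) (n m : nat) (F : {set Exps n m})
    (c : Exps n m -> Exps n m -> K) Kv (i : 'I_n.+1) : (0 < i)%N ->
  (forall A B, c A B != 0 -> A \in F /\ B \notin F) -> (exists A B, c A B != 0) ->
  has_weight c Kv -> (forall g, borel g -> exists lam, eigen_identity F c g lam) ->
  exists M : Exps n m -> Exps n m -> K,
  (forall A A', shifted i A A' -> M A A' = (ex A i)%:R) /\
  (forall A B, A \in F -> B \notin F ->
    \sum_(B0 in ~: F) c A B0 * M B0 B = \sum_(A0 in F) M A A0 * c A0 B).
Proof.
move=> i0 supp [A1 [B1 cAB1]] w eig.
have [g gB gE] := borel_elementary K i0; have [lam gid] := eig g gB.
exists (fun A B => (gact g (mono K A))@_(exm B)); split=> [A A' sh | A B FA nFB].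
  rewrite gE mono_mpolyX (@mcoeff_subst1_elementary _ _ _ _ _ _ 1%N) ?bin1 ?exmE ?opred_neq //.
  by rewrite !mulm1n; apply/shiftedE.
have MAA A2 : (gact g (mono K A2))@_(exm A2) = 1.
  rewrite gE mono_mpolyX (@mcoeff_subst1_elementary _ _ _ _ _ _ 0%N) ?bin0 ?opred_neq //.
have [FA1 nFB1] := supp _ _ cAB1; have := gid A1 B1 FA1 nFB1.
rewrite (has_weight_suml _ w cAB1 nFB1) (has_weight_sumr _ w cAB1 FA1) !MAA mulr1 mul1r.
by rewrite -{1}[c A1 B1]mul1r => /(mulIf cAB1) lam1; rewrite gid // -lam1 mul1r.
Qed.

Theorem mainTheorem8 (K : closedFieldType) (n : nat) (P : {poly rat}) (m : nat)
  (I : pred (Spoly K n)) :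
  [pchar K] =i pred0 ->
  (* z in Hilb: I is the saturated homogeneous ideal of a subscheme of P^n with
     Hilbert polynomial P, and m is the Gotzmann number of P *)
  is_homog_ideal I -> saturated I -> hilbert_poly I P -> gotzmann_number P m ->
  (* z is Borel-fixed *)
  borel_fixed I ->
  forall c : Exps n m -> Exps n m -> K,
  tangent_Hilb I c -> (exists A B, c A B != 0) ->
  let F := Fset m I in
  let R := Rset m I in
  let F' := F :\: [set A | [exists B, (B \in R) && (c A B != 0)]] in
  let F'' := F :|: [set B | (B \in R) && [exists A, (A \in F) && (c A B != 0)]] in
  (borel_eigen I c <->
   exists Kv : 'I_n.+1 -> int,
     [/\ \sum_(j < n.+1) Kv j = 0,
         (forall A B, c A B != 0 -> forall j, (ex B j)%:Z - (ex A j)%:Z = Kv j),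
         is_filter F', is_filter F'' &
         (forall A B : Exps n m, A \in F :\: F' ->
            (forall j, (ex B j)%:Z = (ex A j)%:Z + Kv j) ->
            forall (i : 'I_n.+1) (A' B' : Exps n m), (0 < i)%N ->
              shifted i A A' -> A' \in F :\: F' -> shifted i B B' ->
              c A' B' = (ex B i)%:R / (ex A i)%:R * c A B)]).
Proof.
move=> K0 [idI _] _ _ _ fixI c [supp0 _] [A0 [B0 cAB0]] F R F' F''.
have supp A B : c A B != 0 -> A \in F /\ B \notin F.
  by case/supp0=> FA; rewrite inE.
have filF : is_filter F := Fset_filter K0 idI fixI.
(* Nonzero entries have A in [F] and B outside it, so the sets of condition (2) can be described by
   rows and columns of c alone. *)
have F'P A : reflect (A \in F /\ forall B, c A B = 0) (A \in F').
  rewrite !inE -/(A \in F); apply: (iffP andP) => [[/existsPn cA FA] | [FA cA]]; split=> //.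
    move=> B; apply/eqP; apply: contraT => cAB; have [_ nFB] := supp _ _ cAB.
    by have := cA B; rewrite inE nFB cAB.
  by apply/existsPn => B; rewrite cA eqxx andbF.
have F''P B : reflect (B \in F \/ exists A, c A B != 0) (B \in F'').
  rewrite in_setU; apply: (iffP orP) => [[FB | ] | [FB | [A cAB]]]; [by left | | by left | right].
    by rewrite inE => /andP [_ /existsP [A /andP [_ cAB]]]; right; exists A.
  have [FA nFB] := supp _ _ cAB; rewrite inE inE nFB /=.
  by apply/existsP; exists A; rewrite FA cAB.
have FDP A : reflect (exists B, c A B != 0) (A \in F :\: F').
  rewrite in_setD; apply: (iffP andP) => [[nF'A FA] | [B cAB]]; last first.
    have [FA nFB] := supp _ _ cAB; split=> //; apply/F'P => -[_ cA].
    by rewrite cA eqxx in cAB.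
  apply/existsP; apply: contraR nF'A; rewrite negb_exists => /forallP cA; apply/F'P.
  by split=> // B; apply/eqP; rewrite -[_ == _]negbK.
split=> [[_ eig] | [Kv [_ w filF' filF'' cE]]].
  have eig' g : borel g -> exists lam, eigen_identity F c g lam.
    move=> gB; have [c' [[_ gJ] [lam ec']]] := eig g gB; exists lam => A B FA nFB.
    rewrite (gimage_sub_mcoeff (fun x => (gJ x).1)) // mulr_sumr.
    by apply: eq_bigr => A1 _; rewrite ec' mulrCA.
  have w := eigen_has_weight K0 supp eig' cAB0.
  have derM i i0 := @eigen_der_identity _ _ _ F c _ i i0 supp (ex_intro _ A0 (ex_intro _ B0 cAB0)) w eig'.
  exists (fun j => (ex B0 j)%:Z - (ex A0 j)%:Z); split=> //.
  - rewrite sumrB -!(big_morph Posz PoszD (erefl _)).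
    by rewrite (eqP (valP B0)) (eqP (valP A0)) subrr.
  (* If row A vanishes and c_A'B does not, the identity at (A, B) reads 0 = a_i c_A'B with a_i >
     0. *)
  - move=> i A A' i0 /F'P [FA cA] sh; apply/F'P; split=> [|B]; first exact: filF FA sh.
    apply/eqP; apply: contraT => cAB; have [FA' nFB] := supp _ _ cAB.
    have [M [Msh Mid]] := derM i i0; have := Mid A B FA nFB.
    rewrite big1 => [|B1 _]; last by rewrite cA mul0r.
    rewrite (has_weight_sumr _ w cAB FA') (Msh _ _ sh) => /esym/eqP; rewrite mulf_eq0 (negPf cAB) orbF.
    by move/pcharf0P: K0 => ->; rewrite eqn0Ngt (shifted_pos i0 sh).
  (* The identity at (A, B') has left side b_i c_AB, which is nonzero, so column B' cannot
     vanish. *)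
  - move=> i B B' i0 /F''P [FB sh | [A cAB] sh]; apply/F''P; first by left; apply: filF FB sh.
    have [? | nFB'] := boolP (B' \in F); [by left | right].
    have [FA nFB] := supp _ _ cAB; have [M [Msh Mid]] := derM i i0.
    have := Mid A B' FA nFB'; rewrite (has_weight_suml _ w cAB nFB) (Msh _ _ sh) => e.
    apply/existsP; apply: contraT; rewrite negb_exists => /forallP cB'.
    have : c A B * (ex B i)%:R == 0.
      rewrite e big1 // => A1 _; have := cB' A1; rewrite negbK => /eqP ->.
      by rewrite mulr0.
    rewrite mulf_eq0 (negPf cAB); move/pcharf0P: K0 => ->.
    by rewrite eqn0Ngt (shifted_pos i0 sh).
  (* By the weight, both entries are nonzero; the identity at (A, B') then reads b_i c_AB = a_i
     c_A'B'. *)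
  - move=> A B /FDP [B1 cAB1] wB i A' B' i0 shA /FDP [B2 cAB2] shB.
    have eB : B1 = B by apply: exP => j; move: (w _ _ cAB1 j) (wB j); lia.
    rewrite {}eB in cAB1.
    have sh2 := (has_weight_shifted i w cAB1 cAB2).1 shA.
    rewrite -(shifted_inj shB sh2) in cAB2.
    have [FA nFB] := supp _ _ cAB1; have [FA' nFB'] := supp _ _ cAB2.
    have [M [Msh Mid]] := derM i i0; have := Mid A B' FA nFB'.
    rewrite (has_weight_suml _ w cAB1 nFB) (has_weight_sumr _ w cAB2 FA').
    rewrite (Msh _ _ shA) (Msh _ _ shB) => e.
    have a0 : (ex A i)%:R != 0 :> K.
      by move/pcharf0P: K0 => ->; rewrite -lt0n (shifted_pos i0 shA).
    by apply: (mulfI a0); rewrite -e; field.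
split=> [|g gB]; first by exists A0, B0.
have der (i : 'I_n.+1) : (0 < i)%N -> semi_equivariant F c 1 (der1 'X_(opred i) i).
  move=> i0; apply: (semi_equivariant_der1_opred i0 filF w supp).
  - move=> A A' FA cA sh.
    by have /F'P [] : A' \in F' by apply: (filF' i A A' i0) => //; apply/F'P.
  - move=> A B B' cAB sh nFB'.
    have /F''P [FB' | //] : B' \in F''.
      by apply: (filF'' i B B' i0) => //; apply/F''P; right; exists A.
    by rewrite FB' in nFB'.
  - move=> A B A' B' cAB cAB' shA shB.
    (* Multiplying the ratio condition by a_i, nonzero because A + Delta_i exists, clears the
       denominator. *)
    rewrite (cE A B _ _ i A' B' i0 shA _ shB).
    + have a0 : (ex A i)%:R != 0 :> K.
        by move/pcharf0P: K0 => ->; rewrite -lt0n (shifted_pos i0 shA).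
      by field.
    + by apply/FDP; exists B.
    + by move=> j; rewrite -(w _ _ cAB j) addrC subrK.
    + by apply/FDP; exists B'.
have [lam gJ] := semi_equivariant_iso_act supp (ex_intro _ A0 (ex_intro _ B0 cAB0))
  (semi_equivariant_iso_gact K0 w der gB).
exists (fun A B => lam * c A B); split; last by exists lam.
split=> // A B; rewrite mulf_eq0 negb_or => /andP [_ cAB]; exact: supp0.
Qed.
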